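(* Let $\mathfrak{o}$ be a compact discrete valuation ring with uniformizer $\pi$ and residue field of cardinality $q$, and let $n\ge2$. Then $$\#\{\Lambda\le_s\mathfrak{o}^n:\ [\mathfrak{o}^n:\Lambda]=q^{n+1},\ \Lambda\subseteq\pi\mathfrak{o}^n\}=\binom{n}{1}_q,$$ $$\#\{\Lambda\le_s\mathfrak{o}^n:\ [\mathfrak{o}^n:\Lambda]=q^{n+2},\ \Lambda\subseteq\pi\mathfrak{o}^n\}=\binom{n+1}{2}q^{n-1}+\binom{n}{2}_q.$$
   Context: $\mathfrak{o}^n$ carries componentwise multiplication. $\Lambda\le_s\mathfrak{o}^n$ means that $\Lambda$ is a finite-index $\mathfrak{o}$-submodule of $\mathfrak{o}^n$ closed under multiplication (not required to contain $(1,\dots,1)$). $\binom{n}{r}_q=\prod_{i=0}^{r-1}\frac{1-q^{n-i}}{1-q^{r-i}}$ is the Gaussian binomial, and $\binom{n+1}{2}$ is the ordinary binomial coefficient. *)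

(* Defs.v *)
From HB Require Import structures.
From mathcomp Require Import all_boot all_order all_algebra.
From mathcomp Require Import all_classical topology.

Set Implicit Arguments.
Unset Strict Implicit.
Unset Printing Implicit Defensive.

Import GRing.Theory.

Local Open Scope classical_set_scope.
Local Open Scope card_scope.
Local Open Scope ring_scope.

(* The product o^n. Writing the regular module [o^o] as codomain makes both the
   o-module structure ( *: ) and the componentwise ring structure ( * ) of
   finite functions available on the same type. *)
Notation ffvec o n := {ffun 'I_n -> o^o}.

Definition cosets (V : zmodType) (L : set V) : set (set V) :=
  range (fun x => [set x + y | y in L]).

Definition has_index (V : zmodType) (L : set V) (k : nat) : Prop :=
  cosets L #= `I_k.

Definition ideal (o : idomainType) (I : set o) : Prop :=
  @GRing.submod_closed o o^o [in I].

Definition principal (o : idomainType) (a : o) : set o :=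
  range (fun x => a * x).

Definition nonunits (o : idomainType) : set o :=
  [set x | x \isn't a GRing.unit].
Arguments nonunits o : clear implicits.

(* A discrete valuation ring: a principal ideal domain which is local (the
   non-units form an ideal, then the unique maximal one) and is not a field. *)
Definition is_dvr (o : idomainType) : Prop :=
  [/\ forall I : set o, ideal I -> exists a, I = principal a,
      ideal (nonunits o) &
      nonunits o <> [set 0]].

Definition uniformizer (o : idomainType) (pi : o) : Prop :=
  nonunits o = principal pi.

Definition residue_card (o : idomainType) (q : nat) : Prop :=
  has_index (nonunits o) q.

(* A copy of o carrying the pi-adic topology; when pi is a uniformizer this is
   the valuation topology of o. *)
Definition adic (o : idomainType) (pi : o) : Type := o.

Section AdicTopology.
Variables (o : idomainType) (pi : o).

Definition adic_open (A : set o) : Prop :=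
  forall x, A x -> exists k : nat, forall y, A (x + pi ^+ k * y).

Lemma adic_openT : adic_open setT.
Proof. by move=> x _; exists 0%N. Qed.

Lemma adic_openI : setI_closed adic_open.
Proof.
move=> A B oA oB x [Ax Bx].
have [k Ak] := oA x Ax; have [l Bl] := oB x Bx.
exists (k + l)%N => y; split.
  by rewrite exprD -mulrA.
by rewrite addnC exprD -mulrA.
Qed.

Lemma adic_open_bigU (I : Type) (f : I -> set o) :
  (forall i, adic_open (f i)) -> adic_open (\bigcup_i f i).
Proof.
move=> of_ x [i _ fx]; have [k fk] := of_ i x fx.
by exists k => y; exists i.
Qed.

HB.instance Definition _ := Choice.copy (adic pi) o.
HB.instance Definition _ := @isOpenTopological.Build (adic pi)
  adic_open adic_openT adic_openI adic_open_bigU.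

End AdicTopology.

(* L <=_s o^n; L need not contain the unit (1, ..., 1). *)
Definition subalg_fin_index (o : idomainType) (n : nat) (L : set (ffvec o n))
  : Prop :=
  [/\ GRing.submod_closed [in L],
      forall x y, L x -> L y -> L (x * y) &
      finite_set (cosets L)].

Definition gauss_binom (q n r : nat) : rat :=
  \prod_(i < r) ((1 - q%:R ^+ (n - i)) / (1 - q%:R ^+ (r - i))).

(* A is finite and its number of elements, as a rational number, is c. *)
Definition has_card (T : Type) (A : set T) (c : rat) : Prop :=
  exists2 k : nat, A #= `I_k & k%:R = c.

(* Main.v *)
Require Import Defs.
From HB Require Import structures.
From mathcomp Require Import all_boot all_order all_algebra.
From mathcomp Require Import all_classical topology.
From mathcomp Require Import ring zify.

(* Dividing by pi, the subalgebras L = pi M inside pi o^n of index q^(n+r)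
   correspond to the submodules M of index q^r with pi M M <= M. If M contains
   pi o^n this condition is automatic, and M is given by a subspace of
   codimension r of K^n, K being the residue field; for r = 1 there is no other
   case. If r = 2 and pi e_i is not in M, then o^n / M is cyclic, generated by
   e_i, and M is the kernel of a linear form a : o^n -> o / pi^2. The condition
   then says that the bilinear form sum_l a_l x_l y_l vanishes mod pi on the
   hyperplane a = 0 of K^n, which forces a mod pi to be proportional to e_i^* or
   to e_i^* - e_j^*; each of these C(n + 1, 2) hyperplanes has q^(n - 1) lifts. *)

Set Implicit Arguments.
Unset Strict Implicit.
Unset Printing Implicit Defensive.

Import Order.TTheory GRing.Theory Num.Theory.

(** * Counting subspaces *)

Local Open Scope ring_scope.

Section SubspaceCount.
Variable K : finFieldType.
Local Notation q := #|K|.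

Lemma card_rowspace m n (A : 'M[K]_(m, n)) :
  #|[set v : 'rV_n | (v <= A)%MS]| = (q ^ \rank A)%N.
Proof.
have -> : [set v : 'rV_n | (v <= A)%MS] =
          [set u *m row_base A | u : 'rV_(\rank A)].
  apply/setP => v; rewrite inE -(eq_row_base A).
  by apply/submxP/imsetP => [[u ->] | [u _ ->]]; exists u.
rewrite card_imset; last exact/row_free_inj/row_base_free.
by rewrite card_mx mul1n.
Qed.

Lemma row_free_col_mx r n (v : 'rV[K]_n) (A : 'M_(r, n)) :
  row_free (col_mx v A) = row_free A && ~~ (v <= A)%MS.
Proof.
have rvA : \rank (col_mx v A) = \rank (A + v)%MS.
  by rewrite addsmxC addsmxE.
have leA := rank_leq_row A.
have le1 : (\rank (A + v)%MS <= \rank A + 1)%N.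
  exact: leq_trans (mxrank_adds_leqif _ _) (leq_add (leqnn _) (rank_leq_row v)).
rewrite /row_free rvA; have [vA | vA] := boolP (v <= A)%MS.
  have -> : \rank (A + v)%MS = \rank A by rewrite (addsmx_idPl vA).
  by rewrite andbF; apply/negbTE; lia.
have : (A < A + v)%MS.
  by rewrite ltmxE addsmxSl addsmx_sub submx_refl.
rewrite ltmxErank => /andP [_ ltA]; rewrite andbT.
by apply/eqP/eqP; lia.
Qed.

(** Rows are added on top: above a free block of [r] rows, the admissible new rows are the vectors
    outside its row space, which has [q ^ r] elements. *)
Lemma card_row_free r n :
  #|[set A : 'M[K]_(r, n) | row_free A]| = (\prod_(i < r) (q ^ n - q ^ i))%N.
Proof.
elim: r => [|r IHr].
  rewrite big_ord0 -[RHS](_ : #|[set: 'M[K]_(0, n)]| = _)%N.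
    by apply: eq_card => A; rewrite !inE [A]flatmx0 /row_free mxrank0.
  by rewrite cardsT card_mx mul0n.
rewrite big_ord_recr /= -IHr -sum_nat_const -[LHS]sum1_card.
rewrite (partition_big (dsubmx : 'M[K]_(1 + r, n) -> 'M_(r, n))
          (fun A => row_free A)) => [|M] /=;
  last first.
  by rewrite inE -[M in row_free M]vsubmxK row_free_col_mx => /andP [].
rewrite [RHS](eq_bigl (fun A : 'M_(r, n) => row_free A)) => [|A];
  last by rewrite inE.
apply: eq_bigr => A freeA.
have rA : \rank A = r by apply/eqP.
have qn : (q ^ n)%N = #|[set: 'rV[K]_n]| by rewrite cardsT card_mx mul1n.
rewrite -[X in (_ - _ ^ X)%N]rA -card_rowspace qn -cardsDS ?subsetT //.
rewrite sum1_card.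
rewrite -(card_imset (fun v => v \in [set: _] :\: [set v : 'rV_n | (v <= A)%MS])
            (_ : injective (fun v => col_mx v A))); last first.
  by move=> v w /eq_col_mx [].
apply: eq_card => M; rewrite unfold_in /= inE.
apply/andP/imsetP => [[freeM /eqP MA] | [v]].
  exists (usubmx M); last by rewrite -MA vsubmxK.
  move: freeM; rewrite -[M in row_free M](vsubmxK (m1 := 1)) MA.
  by rewrite row_free_col_mx unfold_in !inE andbT => /andP [].
rewrite unfold_in !inE andbT => vA ->; rewrite col_mxKd; split=> //.
by rewrite (row_free_col_mx v A) freeA.
Qed.

(** Requiring [<<A>>%MS == A] selects one canonical matrix per subspace, so subspaces can be counted
    as matrices. *)
Definition subspaces n r : {set 'M[K]_n} :=
  [set A : 'M_n | (<<A>>%MS == A) && (\rank A == r)].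

(** Double counting of bases: free [r] by [n] matrices are sorted by row space, and those with row
    space [B] are the products of a fixed basis of [B] by an invertible matrix. *)
Lemma card_subspaces_mul n r :
  (#|subspaces n r| * \prod_(i < r) (q ^ r - q ^ i) =
   \prod_(i < r) (q ^ n - q ^ i))%N.
Proof.
rewrite -!card_row_free -sum_nat_const -[RHS]sum1_card.
rewrite [RHS](partition_big (fun A => <<A>>%MS) [in subspaces n r]) => [|A] /=;
  last first.
  by rewrite !inE genmx_id eqxx => /eqP rA; rewrite genmxE rA /=.
apply: eq_bigr => B; rewrite inE => /andP [/eqP gB /eqP rB].
rewrite sum1_card; case: _ / rB; set B0 := row_base B.
have injB : injective (fun X : 'M_(\rank B) => X *m B0).
  exact/row_free_inj/row_base_free.
rewrite -(card_imset _ injB); apply: eq_card => A; rewrite [RHS]unfold_in /= inE.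
have B0B := eq_row_base B.
apply/imsetP/andP => [[X] | [freeA /eqP AB]].
  rewrite inE => freeX ->; split.
    by rewrite /row_free mxrankMfree // row_base_free.
  apply/eqP; rewrite -[RHS]gB; apply: eq_genmx; apply: eqmx_trans B0B.
  by apply: eqmxMfull; rewrite row_full_unit -row_free_unit.
have /submxP [X AX] : (A <= B0)%MS.
  by have := genmxE A; rewrite AB B0B => ->.
exists X => //; rewrite inE; move: freeA.
by rewrite AX /row_free mxrankMfree // row_base_free.
Qed.

(** One inclusion is immediate, and both ranks equal [\rank A] because n - (n - rank) = rank. *)
Lemma eqmx_orthoK n (A : 'M[K]_n) : (kermx (kermx A^T)^T :=: A)%MS.
Proof.
apply/eqmx_sym/eqmxP; rewrite -mxrank_leqif_eq; last first.
  by apply/sub_kermxP; rewrite -[LHS]trmxK trmx_mul trmxK mulmx_ker trmx0.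
by rewrite mxrank_ker mxrank_tr mxrank_ker mxrank_tr subKn // rank_leq_row.
Qed.

(** Passing to the orthogonal complement is injective, since taking it twice gives the subspace
    back. *)
Lemma card_subspaces_le n r :
  (r <= n)%N -> (#|subspaces n r| <= #|subspaces n (n - r)%N|)%N.
Proof.
move=> rn; rewrite -(card_in_imset (f := fun A => <<kermx A^T>>%MS)).
  apply/subset_leq_card/fintype.subsetP => B /imsetP [A].
  rewrite inE => /andP [_ /eqP rA] ->.
  by rewrite inE genmx_id eqxx genmxE mxrank_ker mxrank_tr rA /=.
move=> A B; rewrite !inE => /andP [/eqP gA _] /andP [/eqP gB _] /genmxP.
move=> /eqmxP AB; rewrite -gA -gB; apply: eq_genmx.
apply: eqmx_trans (eqmx_sym (eqmx_orthoK A)) _.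
apply: eqmx_trans (eqmx_orthoK B).
apply/eqmxP/rV_eqP => v.
have ker_tr (C : 'M[K]_n) : (v <= kermx C^T)%MS = (C <= kermx v^T)%MS.
  apply/sub_kermxP/sub_kermxP => /(congr1 trmx);
  by rewrite trmx_mul trmxK trmx0.
by rewrite !ker_tr AB.
Qed.

Lemma card_subspacesC n r :
  (r <= n)%N -> #|subspaces n (n - r)%N| = #|subspaces n r|.
Proof.
move=> rn; apply/eqP; rewrite eqn_leq card_subspaces_le // andbT.
by rewrite -[X in (_ <= #|subspaces n X|)%N](subKn rn) card_subspaces_le // leq_subr.
Qed.

(** Writing q^m - q^i as -q^i (1 - q^(m - i)) for m = n and m = r, the factors -q^i cancel in the
    quotient of the two products. *)
Lemma card_subspaces n r :
  (r <= n)%N -> #|subspaces n r|%:R = gauss_binom q n r :> rat.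
Proof.
move=> rn; have q_gt1 : (1 < q)%N by rewrite card_finNzRing_gt1.
pose d m : rat := \prod_(i < r) (q%:R ^+ m - q%:R ^+ i).
have dE m : (r <= m)%N -> ((\prod_(i < r) (q ^ m - q ^ i))%N)%:R = d m.
  move=> rm; rewrite /d natr_prod; apply: eq_bigr => i _.
  rewrite natrB ?natrX // leq_pexp2l //; first exact: ltnW.
  exact: leq_trans (ltnW (ltn_ord i)) rm.
have qX_neq (i : 'I_r) : (q%:R ^+ (r - i) != 1 :> rat).
  by rewrite -natrX pnatr_eq1 -(expn0 q) eqn_exp2l // subn_eq0 -ltnNge.
have q0 : (q%:R != 0 :> rat) by rewrite pnatr_eq0; lia.
have qD m (i : 'I_r) : (r <= m)%N ->
    q%:R ^+ m - q%:R ^+ i = - q%:R ^+ i * (1 - q%:R ^+ (m - i)) :> rat.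
  move=> rm; rewrite mulrBr mulr1 mulNr -exprD subnKC 1?addrC ?opprK //.
  exact: leq_trans (ltnW (ltn_ord i)) rm.
have d0 : d r != 0.
  rewrite /d; apply/prodf_neq0 => i _; rewrite qD // mulf_neq0 ?oppr_eq0 ?expf_neq0 //.
  by rewrite subr_eq0 eq_sym.
apply: (mulIf d0); rewrite -{1}(dE r) // -natrM card_subspaces_mul dE //.
rewrite /gauss_binom /d -big_split /=; apply: eq_bigr => i _.
rewrite !qD //; set x := q%:R ^+ (r - i); set y := q%:R ^+ i.
have x1 : 1 - x != 0 by rewrite subr_eq0 eq_sym; exact: qX_neq.
by rewrite mulrCA divfK.
Qed.

End SubspaceCount.

Local Open Scope classical_set_scope.
Local Open Scope card_scope.

(** * Cardinalities of finite sets *)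

Lemma card_eq_fin_image (T : finType) (U : Type) (D : {pred T}) (g : T -> U) :
  {in D &, injective g} -> g @` [set t | t \in D] #= `I_#|D|.
Proof.
move=> gI; apply: (@card_eq_trans _ _ _ _ [set t | t \in D]).
  by apply: inj_card_eq => x y; rewrite !inE; exact: gI.
apply: card_eq_trans (card_esym card_II).
have -> : [set t | t \in D] = range (@enum_val T D).
  apply/seteqP; split=> [t /= tD | _ [i _ <-]]; last exact: enum_valP.
  by exists (enum_rank_in tD t) => //; rewrite enum_rankK_in.
by apply: inj_card_eq => x y _ _; exact: enum_val_inj.
Qed.

Lemma has_cardD (T : Type) (A B : set T) (a b : rat) :
  A `&` B = set0 -> has_card A a -> has_card B b -> has_card (A `|` B) (a + b).
Proof.
move=> AB0 [k Ak <-] [l Bl <-]; exists (k + l)%N; last by rewrite natrD.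
have [f [fA fI fS]] := card_set_bijP Ak; have [g [gB gI gS]] := card_set_bijP Bl.
apply/card_set_bijP; exists (fun x => if x \in A then f x else (k + g x)%N).
have nA x : B x -> x \in A = false.
  move=> Bx; apply/negP; rewrite inE => Ax.
  by have : (A `&` B) x by []; rewrite AB0.
split.
- move=> x [Ax | Bx] /=; first by rewrite mem_set //; have /= := fA x Ax; lia.
  by rewrite nA //; have /= := gB x Bx; lia.
- move=> x y; rewrite !inE => -[Ax | Bx] [Ay | By].
  + by rewrite !mem_set //; apply: fI; rewrite inE.
  + by rewrite mem_set // nA //; have /= := fA x Ax; lia.
  + by rewrite nA // mem_set //; have /= := fA y Ay; lia.
  + by rewrite !nA // => /addnI; apply: gI; rewrite inE.
- move=> i /= ikl; have [ik | ki] := ltnP i k.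
    by have [x Ax <-] := fS i ik; exists x; [left | rewrite mem_set].
  have [|x Bx gx] := gS (i - k)%N; first by rewrite /=; lia.
  by exists x; [right | rewrite nA // gx; lia].
Qed.

(** * Index and residue field *)

Section Index.
Variables (V : zmodType) (L : set V).

Lemma coset_eqP (x y : V) : GRing.zmod_closed [in L] ->
  [set x + z | z in L] = [set y + z | z in L] <-> L (x - y).
Proof.
move=> [/set_mem L0 LB]; have {}LB u v : L u -> L v -> L (u - v).
  by move=> Lu Lv; apply/set_mem/LB; exact: mem_set.
have LN u : L u -> L (- u) by move=> Lu; rewrite -sub0r; exact: LB.
have LD u v : L u -> L v -> L (u + v).
  by move=> Lu Lv; rewrite -[v]opprK; exact/LB/LN.
split=> [xy | Lxy].
  have : [set x + z | z in L] x by exists 0; rewrite ?addr0.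
  by rewrite xy => -[z Lz <-]; rewrite addrC addKr.
apply/seteqP; split=> _ [z Lz <-].
  by exists (x - y + z); [exact: LD | rewrite addrA subrKC].
exists (y - x + z); last by rewrite addrA subrKC.
by rewrite -opprB addrC; exact: LB.
Qed.

(** From here on an index is handled through such a map [c] numbering the cosets; [has_index_fin] is
    the way back. *)
Lemma has_index_class k : GRing.zmod_closed [in L] -> has_index L k ->
  exists c : V -> 'I_k, (forall i, exists x, c x = i) /\
    forall x y, c x = c y <-> L (x - y).
Proof.
move=> zL /card_set_bijP [f [fI f_inj fS]].
have cP x : cosets L [set x + z | z in L] by exists x.
exists (fun x => Ordinal (fI _ (cP x))); split=> [i | x y].
  have [_ [x _ <-] fx] := fS i (ltn_ord i).
  by exists x; apply: val_inj.
rewrite -coset_eqP //; split=> [[] | xy]; first by apply: f_inj; rewrite inE.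
by apply: val_inj; rewrite /= xy.
Qed.

Lemma has_index_fin (T : finType) (D : {pred T}) (c : V -> T) :
  (forall x, c x \in D) -> (forall t, t \in D -> exists x, c x = t) ->
  (forall x y, c x = c y <-> L (x - y)) -> has_index L #|D|.
Proof.
move=> cD cS cP; rewrite /has_index.
have -> : cosets L = (fun t => [set x | c x = t]) @` [set t | t \in D].
  have cE x : [set z | c z = c x] = [set x + z | z in L].
    apply/seteqP; split=> [z /= | _ [z Lz <-] /=].
      by rewrite cP => Lzx; exists (z - x); rewrite ?subrKC.
    by apply/cP; rewrite addrC addKr.
  apply/seteqP; split=> [_ [x _ <-] | _ [t /= tD <-]].
    by exists (c x); [exact: cD | exact: cE].
  by have [x <-] := cS t tD; rewrite cE; exists x.
apply: card_eq_fin_image => t u tD _ tu.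
have [x xt] := cS t tD.
by have : [set x | c x = t] x by []; rewrite tu /= xt.
Qed.

Lemma has_index_inj k l : has_index L k -> has_index L l -> k = l.
Proof. by move=> Lk Ll; apply/card_eq_II; apply: card_eq_trans (card_esym Lk) Ll. Qed.

End Index.

(** * The residue field as a finite field on ['I_q] *)

Section ResidueField.
Variables (o : idomainType) (q : nat) (cl : o -> 'I_q) (rep : 'I_q -> o).
Hypotheses (repK : cancel rep cl)
  (clP : forall x y, cl x = cl y <-> nonunits o (x - y))
  (mideal : ideal (nonunits o)).

Let mD x y : nonunits o x -> nonunits o y -> nonunits o (x + y).
Proof.
move=> mx my; have [_ /(_ 1 x y)] := mideal.
by rewrite scale1r => H; apply/set_mem/H; exact: mem_set.
Qed.

Let mM a x : nonunits o x -> nonunits o (a * x).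
Proof.
move=> mx; have [m0 /(_ a x 0)] := mideal.
by rewrite addr0 => H; apply/set_mem/H; first exact: mem_set.
Qed.

Let clK x : nonunits o (rep (cl x) - x).
Proof. by apply/clP; rewrite repK. Qed.

Let clD x y : cl (rep (cl x) + rep (cl y)) = cl (x + y).
Proof. by apply/clP; rewrite opprD addrACA; apply: mD. Qed.

Let clM x y : cl (rep (cl x) * rep (cl y)) = cl (x * y).
Proof.
apply/clP; have -> : rep (cl x) * rep (cl y) - x * y =
    rep (cl y) * (rep (cl x) - x) + x * (rep (cl y) - y) by ring.
by apply: mD; apply: mM.
Qed.

Let clN x : cl (- rep (cl x)) = cl (- x).
Proof. by apply/clP; rewrite -opprD -mulN1r; apply: mM. Qed.

(** The proof argument ties this copy of ['I_q] to [cl] and [rep], through which the operations of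
    [o] are transported. *)
Definition residue_type of cancel rep cl := 'I_q.
Local Notation k := (residue_type repK).

HB.instance Definition _ := Finite.on k.

Let add (x y : k) : k := cl (rep x + rep y).
Let opp (x : k) : k := cl (- rep x).
Let mul (x y : k) : k := cl (rep x * rep y).

Let addA : associative add.
Proof.
by move=> x y z; rewrite -(repK x) -(repK y) -(repK z) /add !clD !repK addrA.
Qed.
Let addC : commutative add.
Proof. by move=> x y; rewrite /add addrC. Qed.
Let add0 : left_id (cl 0) add.
Proof. by move=> x; rewrite -(repK x) /add clD add0r. Qed.
Let addN : left_inverse (cl 0) opp add.
Proof. by move=> x; rewrite -(repK x) /add /opp clN clD addNr. Qed.

HB.instance Definition _ := GRing.isZmodule.Build k addA addC add0 addN.

Let mulA : associative mul.
Proof.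
by move=> x y z; rewrite -(repK x) -(repK y) -(repK z) /mul !clM !repK mulrA.
Qed.
Let mulC : commutative mul.
Proof. by move=> x y; rewrite /mul mulrC. Qed.
Let mul1 : left_id (cl 1) mul.
Proof. by move=> x; rewrite -(repK x) /mul clM mul1r. Qed.
Let mulD : left_distributive mul add.
Proof.
by move=> x y z; rewrite -(repK x) -(repK y) -(repK z) /mul /add !(clD, clM) !repK mulrDl.
Qed.
Let one_neq0 : cl 1 != cl 0 :> k.
Proof.
apply/eqP => /clP; rewrite subr0 /nonunits /= unitr1; exact/negP.
Qed.

HB.instance Definition _ :=
  GRing.Zmodule_isComNzRing.Build k mulA mulC mul1 mulD one_neq0.

Let inv (x : k) : k := cl (rep x)^-1.
Let mulV (x : k) : x != 0 -> inv x * x = 1.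
Proof.
move=> /eqP x0; have ux : rep x \is a GRing.unit.
  apply/negPn/negP => nx; apply: x0; rewrite -[x]repK; apply/clP.
  by rewrite subr0.
by rewrite -[LHS]/(mul _ _) /mul /inv -{2}[x]repK clM mulVr.
Qed.
Let inv0 : inv 0 = 0.
Proof.
(* Inversion in [o] leaves non-units fixed, and the representative of the zero class is a
   non-unit. *)
rewrite /inv invr_out ?repK //.
have : nonunits o (rep (cl 0) - 0) by exact: clK.
by rewrite subr0.
Qed.

HB.instance Definition _ := GRing.ComNzRing_isField.Build k mulV inv0.

Let res (x : o) : k := cl x.
Let resB : zmod_morphism res.
Proof.
move=> x y; rewrite -[RHS]/(add (cl x) (opp (cl y))) /add /opp.
by rewrite clD -[in RHS]clD clN clD.
Qed.
Let resM : monoid_morphism res.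
Proof. by split=> // x y; rewrite -[RHS]/(mul _ _) /mul clM. Qed.
HB.instance Definition _ := GRing.isZmodMorphism.Build o k res resB.
HB.instance Definition _ := GRing.isMonoidMorphism.Build o k res resM.

Lemma residue_field_rep : exists (K : finFieldType) (r : {rmorphism o -> K}),
  [/\ #|K| = q, forall a, exists x, r x = a & forall x, r x = 0 <-> nonunits o x].
Proof.
exists k, res; split=> [|a|x]; first by rewrite card_ord.
  by exists (rep a); exact: repK.
by rewrite -[X in _ <-> _ X]subr0; exact: clP.
Qed.

End ResidueField.

Lemma residue_field (o : idomainType) q :
  ideal (nonunits o) -> residue_card o q ->
  exists (K : finFieldType) (r : {rmorphism o -> K}),
    [/\ #|K| = q, forall a, exists x, r x = a & forall x, r x = 0 <-> nonunits o x].
Proof.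
move=> mideal /has_index_class [].
  exact: (@GRing.submod_closedB o o^o).
move=> cl [/choice [rep repK] clP]; exact: residue_field_rep repK clP mideal.
Qed.

(** * Parameters of the linear forms *)

Section FormParameters.
Variables (K : finFieldType) (n : nat).

(** Each [j] is the larger entry of [j + 1] pairs, and 1 + ... + n is the binomial coefficient. *)
Lemma card_leq_pairs :
  (\sum_(ij : 'I_n * 'I_n | ij.1 <= ij.2) 1 = 'C(n + 1, 2))%N.
Proof.
rewrite -(pair_big_dep predT (fun i j : 'I_n => i <= j)%N (fun _ _ => 1%N)) /=.
rewrite (exchange_big_dep predT) //= addn1 -bin2_sum big_nat_recl // add0n.
rewrite big_mkord; apply: eq_bigr => j _.
rewrite -(big_mkord (fun i => i <= j)%N (fun _ => 1%N)).
rewrite -(big_nat_widen 0 j.+1 n predT) ?ltn_ord //.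
by rewrite sum_nat_const_nat muln1 subn0.
Qed.

(** The entries are the minimum and the maximum of the set {i, j}. This recovers the two indices of
    a form from its support modulo [pi]. *)
Lemma leq_pair_inj (i j i' j' : 'I_n) : (i <= j)%N -> (i' <= j')%N ->
  (forall l, (l == i) || (l == j) = (l == i') || (l == j')) -> i = i' /\ j = j'.
Proof.
move=> ij ij' E.
have {E} E (l : 'I_n) : ((l : nat) == i) || ((l : nat) == j) =
    ((l : nat) == i') || ((l : nat) == j').
  exact: E.
have := E i; have := E j; have := E i'; have := E j'.
by split; apply: val_inj => /=; lia.
Qed.

Definition form_param : finType := ('I_n * 'I_n * {ffun 'I_n -> K})%type.

(* (i, j, c) stands for the linear form e_i^* - e_j^* + pi c^*, without the
   term e_j^* if j = i; the coefficient at i is normalized to 1. *)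
Definition form_params : {pred form_param} :=
  [pred p : form_param | (p.1.1 <= p.1.2)%N & p.2 p.1.1 == 0].

(** For a given pair, [c] vanishes at [i] and is free at the other n - 1 indices. *)
Lemma card_form_params : #|form_params| = ('C(n + 1, 2) * #|K| ^ (n - 1))%N.
Proof.
have cardc (i : 'I_n) :
    #|[pred c : {ffun 'I_n -> K} | c i == 0]| = (#|K| ^ (n - 1))%N.
  have -> : (n - 1 = #|predC1 i|)%N by rewrite cardC1 card_ord subn1.
  rewrite -(card_pffun_on 0 (predC1 i) (predT : {pred K})).
  apply: eq_card => c; rewrite !inE.
  apply/eqP/pffun_onP => [ci | [/fintype.subsetP cs _]].
    split=> //; apply/fintype.subsetP => l; rewrite !inE.
    by apply: contraNneq => ->; rewrite ci.
  by apply/eqP; apply: contraT => ci; have := cs i ci; rewrite !inE eqxx.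
have -> : #|form_params| =
    (\sum_(ij : 'I_n * 'I_n | ij.1 <= ij.2) #|K| ^ (n - 1))%N.
  rewrite -sum1_card.
  rewrite -(pair_big_dep (fun ij : 'I_n * 'I_n => (ij.1 <= ij.2)%N)
    (fun ij (c : {ffun 'I_n -> K}) => c ij.1 == 0) (fun _ _ => 1%N)) /=.
  by apply: eq_bigr => ij _; rewrite -(cardc ij.1) -sum1_card.
by rewrite -card_leq_pairs big_distrl; apply: eq_bigr => ij _; rewrite [RHS]mul1n.
Qed.

End FormParameters.

(** * Submodules of o^n *)

Section Submodules.
Variables (R : pzRingType) (V : lmodType R) (M : set V).

Lemma submod_setP : GRing.submod_closed [in M] <->
  M 0 /\ forall a u v, M u -> M v -> M (a *: u + v).
Proof.
split=> -[M0 ML].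
  split=> [|a u v Mu Mv]; first exact: set_mem.
  by apply/set_mem/ML; exact: mem_set.
split=> [|a u v /set_mem Mu /set_mem Mv]; first exact: mem_set.
by apply/mem_set/ML.
Qed.

Hypothesis subM : GRing.submod_closed [in M].

Lemma submod_set0 : M 0. Proof. by have /submod_setP [] := subM. Qed.

Lemma submod_setD u v : M u -> M v -> M (u + v).
Proof.
by move=> Mu Mv; have /submod_setP [_ /(_ 1 u v)] := subM; rewrite scale1r; apply.
Qed.

Lemma submod_setZ a u : M u -> M (a *: u).
Proof.
move=> Mu; have /submod_setP [M0 /(_ a u 0)] := subM.
by rewrite addr0; apply.
Qed.

Lemma submod_setB u v : M u -> M v -> M (u - v).
Proof. by move=> Mu Mv; rewrite -scaleN1r; apply/submod_setD/submod_setZ. Qed.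

Lemma submod_set_sum I (s : seq I) (F : I -> V) :
  (forall i, M (F i)) -> M (\sum_(i <- s) F i).
Proof. by move=> MF; apply: big_ind => //; [exact: submod_set0 | exact: submod_setD]. Qed.

End Submodules.

(** * Dividing submodules by [pi] *)

Section Lattices.
Variables (o : idomainType) (pi : o) (K : finFieldType).
Variables (res : {rmorphism o -> K}) (rep : K -> o) (quo : o -> o) (n : nat).
Hypotheses (pi0 : pi != 0) (repK : cancel rep res) (rep0 : rep 0 = 0).
Hypotheses (res_pi : res pi = 0) (quoP : forall x, x = rep (res x) + pi * quo x).
Hypothesis res_unit : forall x, res x != 0 -> x \is a GRing.unit.
Local Notation q := #|K|.
Local Notation V := (ffvec o n).
Local Notation submod M := (GRing.submod_closed [in M]).

Let res_piM x : res (pi * x) = 0.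
Proof. by rewrite rmorphM res_pi mul0r. Qed.

Let res0P x : res x = 0 -> x = pi * quo x.
Proof. by move=> x0; rewrite {1}[x]quoP x0 rep0 add0r. Qed.

(** Uniqueness of the [pi]-adic expansion: [rep (res x)] is the leading digit of [x] and [quo x] is
    what follows it. *)
Let quo_rep a x : quo (rep a + pi * x) = x.
Proof.
have := quoP (rep a + pi * x).
by rewrite rmorphD res_piM addr0 repK => /addrI /(mulfI pi0).
Qed.

Definition pi_scale (M : set V) : set V := [set pi *: x | x in M].

Lemma pi_scaleE M x : pi_scale M (pi *: x) <-> M x.
Proof.
split=> [[y My /ffunP yx] | Mx]; last by exists x.
suff -> : x = y by [].
by apply/ffunP => i; have := yx i; rewrite !ffunE => /(mulfI pi0).
Qed.

Lemma pi_scaleM (x y : V) : (pi *: x) * (pi *: y) = pi *: (pi *: (x * y)).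
Proof.
apply/ffunP => i; rewrite !ffunE.
by rewrite -[LHS]/((pi * x i : o) * (pi * y i)) mulrACA -mulrA.
Qed.

Lemma pi_scale_inj : injective pi_scale.
Proof.
move=> M N MN; apply/seteqP; split=> x /pi_scaleE; [rewrite MN | rewrite -MN];
  exact: (pi_scaleE _ x).1.
Qed.

Lemma pi_scale_submod M : submod M -> submod (pi_scale M).
Proof.
move=> subM; apply/submod_setP; split.
  by exists 0; [exact: submod_set0 | rewrite scaler0].
move=> a _ _ [x Mx <-] [y My <-]; exists (a *: x + y).
  by apply: submod_setD => //; apply: submod_setZ.
by rewrite scalerDr !scalerA mulrC.
Qed.

Definition red (x : V) : 'rV[K]_n := \row_i res (x i).

Lemma red_linear a x y : red (a *: x + y) = res a *: red x + red y.
Proof. by apply/rowP => i; rewrite !mxE !ffunE rmorphD rmorphM. Qed.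

Lemma redB x y : red (x - y) = red x - red y.
Proof.
by rewrite -scaleN1r addrC red_linear rmorphN rmorph1 scaleN1r addrC.
Qed.

Lemma red_surj v : exists x, red x = v.
Proof.
by exists [ffun i => rep (v 0 i)]; apply/rowP => i; rewrite !mxE ffunE repK.
Qed.

Lemma red_scale x : red (pi *: x) = 0.
Proof. by apply/rowP => i; rewrite !mxE ffunE res_piM. Qed.

Lemma red_eq0 x : red x = 0 -> exists y, x = pi *: y.
Proof.
move=> /rowP x0; exists [ffun i => quo (x i)]; apply/ffunP => i.
by rewrite !ffunE; apply: res0P; have := x0 i; rewrite !mxE.
Qed.

(** The class of [x] modulo [pi M] amounts to its reduction in K^n, with q^n values, and the class
    modulo [M] of what remains after removing the leading digits. *)
Lemma pi_scale_index_of M k : submod M ->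
  has_index M k -> has_index (pi_scale M) (q ^ n * k).
Proof.
move=> subM /has_index_class [].
  exact: GRing.submod_closedB.
move=> c [cS cP].
have -> : (q ^ n * k = #|{: 'rV[K]_n * 'I_k}|)%N.
  by rewrite card_prod card_mx mul1n card_ord.
pose dv (x : V) : V := [ffun i => quo (x i)].
(* The map [dv] need not be additive, but equal reductions have equal leading digits, which cancel
   in the difference. *)
have dvP x y : red x = red y -> x - y = pi *: (dv x - dv y).
  move=> /rowP xy; apply/ffunP => i; rewrite !ffunE /=.
  have := xy i; rewrite !mxE => xyi.
  by rewrite {1}[x i]quoP {1}[y i]quoP xyi opprD addrACA subrr add0r -mulrBr.
apply: (has_index_fin (c := fun x => (red x, c (dv x)))) => // [[v t] _|x y].
  have [z <-] := cS t; exists ([ffun i => rep (v 0 i) + pi * z i]).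
  congr (_, c _); last by apply/ffunP => i; rewrite !ffunE quo_rep.
  by apply/rowP => i; rewrite !mxE ffunE rmorphD res_piM addr0 repK.
split=> [[rxy /cP Mxy] | [m Mm mxy]].
  by rewrite dvP //; apply/pi_scaleE.
have rxy : red x = red y by apply/eqP; rewrite -subr_eq0 -redB -mxy red_scale.
congr (_, _) => //; apply/cP/pi_scaleE; rewrite -dvP // -mxy.
by apply/pi_scaleE.
Qed.

(** For the direct implication, the map sending [x] to the class of [pi *: x] shows that [M] has
    some finite index l; then q^n k = q^n l. *)
Lemma pi_scale_index M k : submod M ->
  has_index (pi_scale M) (q ^ n * k) <-> has_index M k.
Proof.
move=> subM; split=> [pM | Mk]; last exact: pi_scale_index_of.
have := pM => /has_index_class [].
  exact/GRing.submod_closedB/pi_scale_submod.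
move=> c [cS cP].
have : has_index M #|[pred t | `[<exists x, c (pi *: x) = t>]]|.
  apply: (has_index_fin (c := fun x => c (pi *: x))) => [x|t|x y].
  - by rewrite inE; exists x.
  - by rewrite inE.
  - by rewrite cP -scalerBr pi_scaleE.
set l := #|_| => Ml; suff -> : k = l by [].
have := has_index_inj pM (pi_scale_index_of subM Ml).
by move/eqP; rewrite eqn_pmul2l ?expn_gt0 ?(ltnW (card_finNzRing_gt1 _)) // => /eqP.
Qed.

(** The last clause expresses that [pi M] is closed under products, as (pi x)(pi y) = pi (pi x
    y). *)
Definition pi_subalgs r := [set M : set V | [/\ submod M, has_index M (q ^ r) &
  forall x y, M x -> M y -> M (pi *: (x * y))]].

Lemma subalgs_pi_scale r :
  [set L : set V | [/\ subalg_fin_index L, has_index L (q ^ (n + r)) &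
     L `<=` range (fun x : V => pi *: x)]] = pi_scale @` pi_subalgs r.
Proof.
apply/seteqP; split=> [L [[subL mulL _] iL Lpi] | _ [M [subM iM mulM] <-]].
  pose M : set V := [set x | L (pi *: x)].
  have LM : pi_scale M = L.
    apply/seteqP; split=> [_ [x Mx <-] // | x Lx].
    by have [y _ yx] := Lpi x Lx; exists y => //; rewrite /M /= yx.
  have subM : submod M.
    apply/submod_setP; split; first by rewrite /M /= scaler0; exact: submod_set0.
    move=> a u v Mu Mv; rewrite /M /= scalerDr scalerA mulrC -scalerA.
    by apply: submod_setD => //; apply: submod_setZ.
  exists M => //; split=> // [|x y Mx My].
    by apply/pi_scale_index => //; rewrite LM -expnD.
  by rewrite /M /= -pi_scaleM; exact: mulL.
have iL : has_index (pi_scale M) (q ^ (n + r)).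
  by rewrite expnD; apply/pi_scale_index.
split=> // [|_ [x _ <-]]; last by exists x.
split; [exact: pi_scale_submod | | by apply/finite_setP; exists (q ^ (n + r))%N].
move=> _ _ [x Mx <-] [y My <-]; exists (pi *: (x * y)); first exact: mulM.
by rewrite pi_scaleM.
Qed.

(** * Submodules containing pi o^n, as preimages of subspaces of K^n *)

Definition lattice_of (A : 'M[K]_n) : set V := [set x | (red x <= A)%MS].

Lemma lattice_of_submod A : submod (lattice_of A).
Proof.
apply/submod_setP; split=> [|a u v uA vA]; rewrite /lattice_of /=.
  by rewrite -(scaler0 _ pi) red_scale sub0mx.
by rewrite red_linear addmx_sub // scalemx_sub.
Qed.

(** The quotient is K^n modulo the row space of [A], realized as the image of [cokermx A]. *)
Lemma lattice_of_index A : has_index (lattice_of A) (q ^ (n - \rank A)).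
Proof.
rewrite -mxrank_coker -card_rowspace.
apply: (has_index_fin (c := fun x => red x *m cokermx A)) => [x|v|x y].
- by rewrite inE submxMl.
- by rewrite inE => /submxP [w ->]; have [x <-] := red_surj w; exists x.
- rewrite /lattice_of /= submxE redB mulmxBl subr_eq0.
  by split=> [->|/eqP].
Qed.

Lemma lattice_of_inj r : {in subspaces K n r &, injective lattice_of}.
Proof.
move=> A B; rewrite !inE => /andP [/eqP gA _] /andP [/eqP gB _] AB.
rewrite -gA -gB; apply/eq_genmx/eqmxP/rV_eqP => v.
have [x <-] := red_surj v.
by apply/idP/idP; [rewrite -[is_true _]/(lattice_of A x) AB |
  rewrite -[is_true _]/(lattice_of B x) -AB].
Qed.

(** [A] spans the reductions of the elements of [M]. A vector whose reduction lies in this span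
    differs from an element of [M] by a multiple of [pi], which is again in [M]. *)
Lemma lattice_of_surj (M : set V) : submod M -> (forall x, M (pi *: x)) ->
  exists2 A, <<A>>%MS = A & lattice_of A = M.
Proof.
move=> subM piM; pose S := [set v | `[<exists2 x, M x & red x = v>]]%SET.
pose B := \matrix_(i < #|S|) enum_val i.
have rowB i : exists2 x, M x & red x = row i B.
  by rewrite rowK; have := enum_valP i; rewrite inE => /asboolP.
exists (<<B>>)%MS; first exact: genmx_id.
apply/seteqP; split=> x; rewrite /lattice_of /= genmxE;
  [move=> /submxP [u xu] | move=> Mx].
  suff [m Mm mx] : exists2 m, M m & red m = red x.
    have [y xy] : exists y, x - m = pi *: y.
      by apply: red_eq0; rewrite redB mx subrr.
    by rewrite -(subrK m x) xy; apply: submod_setD.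
  rewrite xu mulmx_sum_row; elim/big_ind: _ => [|v w [x1 M1 <-] [x2 M2 <-]|i _].
  - exists 0; first exact: submod_set0.
    by rewrite -(scaler0 _ pi) red_scale.
  - exists (x1 + x2); first exact: submod_setD.
    by rewrite -[x1]scale1r red_linear rmorph1 !scale1r.
  - have [m Mm <-] := rowB i; exists (rep (u 0 i) *: m); first exact: submod_setZ.
    rewrite -[_ *: m]addr0 red_linear repK -(scaler0 _ pi) red_scale.
    by rewrite addr0.
have xS : red x \in S by rewrite inE; apply/asboolP; exists x.
by rewrite -(enum_rankK_in xS xS) -rowK row_sub.
Qed.

(** Index q^r means rank n - r, so duality of subspaces yields the binomial at [r]. The product
    condition is automatic, every multiple of [pi] being in [M]. *)
Lemma card_pi_subalgs_above r : (r <= n)%N ->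
  has_card (pi_subalgs r `&` [set M | forall x, M (pi *: x)]) (gauss_binom q n r).
Proof.
move=> rn; exists #|subspaces K n (n - r)%N|; last first.
  by rewrite card_subspacesC // card_subspaces.
suff -> : pi_subalgs r `&` [set M | forall x, M (pi *: x)] =
    lattice_of @` [set A | A \in subspaces K n (n - r)%N].
  exact/card_eq_fin_image/lattice_of_inj.
apply/seteqP; split=> [M [[subM iM _] piM] | _ [A /= sA <-]].
  have [A gA AM] := lattice_of_surj subM piM; exists A => //=.
  rewrite inE gA eqxx /=; have := has_index_inj iM; rewrite -AM.
  move=> /(_ _ (lattice_of_index A)) /eqP.
  rewrite eqn_exp2l ?card_finNzRing_gt1 // => /eqP ->.
  by rewrite subKn ?rank_leq_row.
have piA x : lattice_of A (pi *: x) by rewrite /lattice_of /= red_scale sub0mx.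
split=> //; split; [exact: lattice_of_submod | | by []].
have -> : r = (n - \rank A)%N; last exact: lattice_of_index.
by move: sA; rewrite inE => /andP [_ /eqP ->]; rewrite subKn.
Qed.

(** * Submodules missing some pi e *)

Section Cyclic.
Variables (M : set V) (e : V).
Hypotheses (subM : submod M) (Mpe : ~ M (pi *: e)).

(** If [a] or [quo a] were a unit, it could be inverted and [pi *: e] would lie in [M]; so two
    digits of [a] vanish. *)
Lemma annihilator_pi2 a : M (a *: e) -> exists d, a = pi ^+ 2 * d.
Proof.
have unit_pi u x : res u != 0 -> M (u *: x) -> M x.
  move=> /res_unit uu Mu; rewrite -[x](scale1r) -(mulVr uu) -scalerA.
  exact: submod_setZ.
move=> Ma; have a0 : res a = 0.
  apply/eqP/negPn/negP => /unit_pi /(_ Ma) Me; apply: Mpe.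
  exact: submod_setZ.
have q0 : res (quo a) = 0.
  apply/eqP/negPn/negP => /unit_pi qa; apply: Mpe; apply: qa.
  by rewrite scalerA mulrC -res0P.
by exists (quo (quo a)); rewrite {1}(res0P a0) {1}(res0P q0) mulrA.
Qed.

Variables (k : nat) (c : V -> 'I_k).
Hypothesis cP : forall x y, c x = c y <-> M (x - y).

Let f (t : K * K) := c ((rep t.1 + pi * rep t.2) *: e).

(** Two scalars with two digits that give the same class differ by a multiple of pi^2, so their
    digits agree one after the other. *)
Lemma cyclic_class_inj : injective f.
Proof.
move=> [a b] [a' b'] /cP; rewrite -scalerBl => /annihilator_pi2 [d] /=.
rewrite opprD addrACA -mulrBr expr2 -mulrA => abd.
have := congr1 res abd; rewrite rmorphD !res_piM addr0 rmorphB /= !repK.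
move=> /eqP; rewrite subr_eq0 => /eqP aa'; rewrite aa' in abd *.
move: abd; rewrite subrr add0r => /(mulfI pi0) /(congr1 res).
by rewrite res_piM rmorphB /= !repK => /eqP; rewrite subr_eq0 => /eqP ->.
Qed.

Lemma cyclic_index_ge : (q ^ 2 <= k)%N.
Proof.
have := leq_card _ cyclic_class_inj.
by rewrite card_prod card_ord mulnn.
Qed.

Hypothesis kq : k = (q ^ 2)%N.

Let cyclic_class_onto i : i \in codom f.
Proof.
by apply: inj_card_onto cyclic_class_inj _ i; rewrite card_prod card_ord kq mulnn.
Qed.

(** When the index is q^2, the q^2 distinct classes of two-digit multiples of [e] exhaust the
    quotient. *)
Lemma cyclic_generated x : exists a, M (x - a *: e).
Proof.
have /codomP [t xt] := cyclic_class_onto (c x).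
by exists (rep t.1 + pi * rep t.2); apply/cP.
Qed.

(** Some two-digit multiple of [e] is congruent to pi^2 e; by [annihilator_pi2] its scalar is
    divisible by pi^2, so both digits are zero. *)
Lemma cyclic_pi2 : M (pi ^+ 2 *: e).
Proof.
have /codomP [[a b] /cP] := cyclic_class_onto (c (pi ^+ 2 *: e)).
rewrite -scalerBl => Mab; have [d] := annihilator_pi2 Mab.
move: Mab; rewrite /= expr2 => Mab abd.
have := congr1 res abd; rewrite -mulrA !(rmorphB, rmorphD) !res_piM /= repK.
rewrite addr0 sub0r => /eqP; rewrite oppr_eq0 => /eqP a0.
move: abd Mab; rewrite a0 rep0 add0r -!mulrA -!mulrBr => /(mulfI pi0).
move=> /(congr1 res); rewrite rmorphB res_piM /= res_pi repK sub0r => /eqP.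
by rewrite oppr_eq0 => /eqP ->; rewrite rep0 subr0.
Qed.

End Cyclic.

(** Missing some pi e would force the index to be at least q^2. *)
Lemma pi_subalgs1_above : pi_subalgs 1 `<=` [set M | forall x, M (pi *: x)].
Proof.
move=> M [subM iM _] e; apply: contrapT => Mpe.
have [c [_ cP]] := has_index_class (GRing.submod_closedB subM) iM.
have := cyclic_index_ge subM Mpe cP.
by rewrite leq_exp2l // card_finNzRing_gt1.
Qed.

(** * Kernels of linear forms modulo pi^2 *)

Local Notation param := (form_param K n).
Implicit Types p : param.

Definition unit_vec (l : 'I_n) : V := [ffun m => (m == l)%:R].

Lemma unit_vec_sum (x : V) : x = \sum_l x l *: unit_vec l.
Proof.
apply/ffunP => m; rewrite sum_ffunE (bigD1 m) //= big1 => [|l lm].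
  by rewrite !ffunE eqxx addr0 [RHS]mulr1.
by rewrite !ffunE eq_sym (negPf lm) [LHS]mulr0.
Qed.

Definition lin_form (a : 'I_n -> o) (x : V) : o := \sum_l a l * x l.

Lemma lin_form_linear a b (x y : V) :
  lin_form a (b *: x + y) = b * lin_form a x + lin_form a y.
Proof.
rewrite /lin_form mulr_sumr -big_split; apply: eq_bigr => l _ /=.
by rewrite !ffunE [LHS]mulrDr mulrCA.
Qed.

Lemma lin_form0 a : lin_form a 0 = 0.
Proof. by rewrite /lin_form big1 // => l _; rewrite ffunE mulr0. Qed.

Lemma lin_formZ a b (x : V) : lin_form a (b *: x) = b * lin_form a x.
Proof. by rewrite -[b *: x]addr0 lin_form_linear lin_form0 addr0. Qed.

Lemma lin_formB a (x y : V) : lin_form a (x - y) = lin_form a x - lin_form a y.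
Proof. by rewrite -scaleN1r addrC lin_form_linear mulN1r addrC. Qed.

Lemma lin_form_unit a l : lin_form a (unit_vec l) = a l.
Proof.
rewrite /lin_form (bigD1 l) //= big1 => [|m ml].
  by rewrite ffunE eqxx mulr1 addr0.
by rewrite ffunE (negPf ml) mulr0.
Qed.

Definition pi2_multiple (x : o) := exists d, x = pi ^+ 2 * d.

Lemma pi2_multipleD x y :
  pi2_multiple x -> pi2_multiple y -> pi2_multiple (x + y).
Proof. by move=> [c ->] [d ->]; exists (c + d); rewrite mulrDr. Qed.

Lemma pi2_multipleM a x : pi2_multiple x -> pi2_multiple (a * x).
Proof. by move=> [d ->]; exists (a * d); rewrite mulrCA. Qed.

Lemma pi2_multipleN x : pi2_multiple x -> pi2_multiple (- x).
Proof. by move=> [d ->]; exists (- d); rewrite mulrN. Qed.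

Lemma pi2_multiple_pi x : pi2_multiple (pi * x) <-> res x = 0.
Proof.
split=> [[d] | /res0P ->]; last by exists (quo x); rewrite mulrA.
by rewrite expr2 -mulrA => /(mulfI pi0) ->.
Qed.

(** The first two digits, standing for the class of [x] in o / pi^2. *)
Definition class2 x := (res x, res (quo x)).

Lemma class2P x y : class2 x = class2 y <-> pi2_multiple (x - y).
Proof.
rewrite {2}[x]quoP {2}[y]quoP opprD addrACA -mulrBr; split=> [[-> qxy] | [d]].
  rewrite subrr add0r; apply/pi2_multiple_pi.
  by rewrite rmorphB /= qxy subrr.
rewrite expr2 -mulrA => xyd; have := congr1 res xyd.
rewrite rmorphD !res_piM rmorphB /= !repK addr0 => /subr0_eq xy.
move: xyd; rewrite xy subrr add0r => /(mulfI pi0) /(congr1 res).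
by rewrite res_piM rmorphB /= => /subr0_eq qxy; rewrite /class2 xy qxy.
Qed.

Lemma class2_surj t : exists x, class2 x = t.
Proof.
case: t => a b; exists (rep a + pi * rep b).
by rewrite /class2 quo_rep rmorphD res_piM addr0 !repK.
Qed.

Definition form_lattice (a : 'I_n -> o) : set V :=
  [set x | pi2_multiple (lin_form a x)].

Lemma form_lattice_submod a : submod (form_lattice a).
Proof.
apply/submod_setP; split=> [|b x y xa ya]; rewrite /form_lattice /=.
  by rewrite lin_form0; exists 0; rewrite mulr0.
by rewrite lin_form_linear; apply: pi2_multipleD => //; apply: pi2_multipleM.
Qed.

(** The coefficient 1 makes the form surjective onto o / pi^2, which has q^2 elements. *)
Lemma form_lattice_index a i : a i = 1 -> has_index (form_lattice a) (q ^ 2).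
Proof.
move=> ai; have -> : (q ^ 2 = #|{: K * K}|)%N by rewrite card_prod mulnn.
apply: (has_index_fin (c := class2 \o lin_form a)) => // [t _|x y] /=.
  have [b <-] := class2_surj t; exists (b *: unit_vec i).
  by rewrite lin_formZ lin_form_unit ai mulr1.
by rewrite class2P /form_lattice /= lin_formB.
Qed.

Lemma eq_form_lattice a b :
  (forall l, pi2_multiple (a l - b l)) -> form_lattice a = form_lattice b.
Proof.
suff sub a' b' : (forall l, pi2_multiple (a' l - b' l)) ->
    form_lattice a' `<=` form_lattice b'.
  move=> ab; apply/seteqP; split; apply: sub => // l.
  by rewrite -opprB; apply: pi2_multipleN.
move=> ab x; rewrite /form_lattice /= => ax.
rewrite -[lin_form b' x](subKr (lin_form a' x)); apply: pi2_multipleD => //.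
apply: pi2_multipleN; rewrite /lin_form -sumrB.
elim/big_ind: _ => [|u v|l _]; first by exists 0; rewrite mulr0.
  exact: pi2_multipleD.
by rewrite -mulrBl mulrC; apply: pi2_multipleM.
Qed.

Definition coef p (l : 'I_n) : o :=
  (l == p.1.1)%:R - ((l == p.1.2) && (p.1.2 != p.1.1))%:R + pi * rep (p.2 l).

Lemma coef_lead p : p \in @form_params K n -> coef p p.1.1 = 1.
Proof.
rewrite inE /coef => /andP [_ /eqP ->]; rewrite eqxx rep0 mulr0 addr0.
by rewrite eq_sym andbN subr0.
Qed.

Lemma res_coef p l : res (coef p l) =
  (l == p.1.1)%:R - ((l == p.1.2) && (p.1.2 != p.1.1))%:R.
Proof. by rewrite /coef rmorphD res_piM addr0 rmorphB !rmorph_nat. Qed.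

Lemma res_coef_neq0 p l :
  (res (coef p l) != 0) = (l == p.1.1) || (l == p.1.2).
Proof.
rewrite res_coef; case: (eqVneq l p.1.1) => [->|li] /=.
  by rewrite [_ == p.1.2]eq_sym andbN subr0 oner_neq0.
rewrite sub0r oppr_eq0; case: (eqVneq l p.1.2) => [<-|lj] /=; last by rewrite eqxx.
by rewrite li oner_neq0.
Qed.

Lemma res_lin_form p x : res (lin_form (coef p) x) =
  res (x p.1.1) - (p.1.2 != p.1.1)%:R * res (x p.1.2).
Proof.
rewrite rmorph_sum /=.
under eq_bigr => l _ do rewrite rmorphM res_coef mulrBl.
rewrite sumrB; congr (_ - _).
  rewrite (bigD1 p.1.1) //= eqxx mul1r big1 ?addr0 // => l li.
  by rewrite (negPf li) mul0r.
rewrite (bigD1 p.1.2) //= eqxx big1 ?addr0 // => l lj.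
by rewrite (negPf lj) mul0r.
Qed.

(** Modulo [pi], the elements satisfy x_i = x_j, or x_i = 0 if i = j, and either equation passes to
    componentwise products. The nonzero residue of the coefficient at i excludes pi e_i. *)
Lemma coef_lattice_good p : p \in @form_params K n ->
  (pi_subalgs 2 `\` [set M | forall x, M (pi *: x)]) (form_lattice (coef p)).
Proof.
move=> pP; split; last first.
  move=> /(_ (unit_vec p.1.1)); rewrite /form_lattice /= lin_formZ lin_form_unit.
  by rewrite pi2_multiple_pi; apply/eqP; rewrite res_coef_neq0 eqxx.
split; first exact: form_lattice_submod.
  exact/form_lattice_index/coef_lead.
move=> x y; rewrite /form_lattice /= => -[d /(congr1 res)] xd [e /(congr1 res) ye].
rewrite lin_formZ pi2_multiple_pi; move: xd ye.
rewrite !res_lin_form expr2 -!mulrA !res_piM => /subr0_eq xi /subr0_eq yi.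
have xyE l : res ((x * y) l) = res (x l) * res (y l) by rewrite ffunE rmorphM.
rewrite !xyE xi yi; case: (_ != _); rewrite !(mul1r, mul0r) ?mulr0 subrr //.
Qed.

(** The indices l with pi e_l outside the lattice are exactly i and j. Then e_l - a_l e_i, where a_l
    is the coefficient at l, lies in the lattice and determines a_l modulo pi^2, hence the digit
    c_l. *)
Lemma coef_lattice_inj : {in @form_params K n &,
  injective (fun p => form_lattice (coef p))}.
Proof.
move=> p p' pP p'P pp'.
have support l r : form_lattice (coef r) (pi *: unit_vec l) <->
    ~~ ((l == r.1.1) || (l == r.1.2)).
  rewrite /form_lattice /= lin_formZ lin_form_unit pi2_multiple_pi.
  by rewrite -res_coef_neq0 negbK; split=> [->|/eqP].
have eqsupp l : (l == p.1.1) || (l == p.1.2) = (l == p'.1.1) || (l == p'.1.2).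
  by apply: negb_inj; apply/idP/idP => /support H; apply/support;
    rewrite ?pp' // -pp'.
have [eqi eqj] : p.1.1 = p'.1.1 /\ p.1.2 = p'.1.2.
  move: (pP) (p'P); rewrite !inE => /andP [ij _] /andP [ij' _].
  exact: leq_pair_inj.
have eqij : p.1 = p'.1 by rewrite [LHS]surjective_pairing eqi eqj -surjective_pairing.
have eqc l : p.2 l = p'.2 l.
  have : form_lattice (coef p) (unit_vec l - coef p l *: unit_vec p.1.1).
    rewrite /form_lattice /= lin_formB lin_formZ !lin_form_unit coef_lead //.
    by rewrite mulr1 subrr; exists 0; rewrite mulr0.
  rewrite pp' /form_lattice /= lin_formB lin_formZ !lin_form_unit eqij.
  rewrite coef_lead // mulr1 /coef eqij opprD addrACA subrr add0r -mulrBr pi2_multiple_pi.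
  by rewrite rmorphB /= !repK => /subr0_eq.
rewrite [LHS]surjective_pairing [RHS]surjective_pairing eqij.
by congr (_, _); apply/ffunP.
Qed.

Lemma coef_lattice_surj M : pi_subalgs 2 M -> ~ (forall x, M (pi *: x)) ->
  exists2 p, p \in @form_params K n & form_lattice (coef p) = M.
Proof.
move=> [subM iM mulM] npi.
(* The least such [i] is taken so that the second index found below satisfies i <= j. *)
have [i Mi min_i] : exists2 i, ~ M (pi *: unit_vec i) &
    forall l : 'I_n, (l < i)%N -> M (pi *: unit_vec l).
  pose P (l : 'I_n) := ~~ `[<M (pi *: unit_vec l)>].
  have [l0 Pl0] : exists l, P l.
    apply: contrapT => nP; apply: npi => x.
    rewrite [x]unit_vec_sum scaler_sumr; apply: submod_set_sum => // l.
    rewrite scalerA mulrC -scalerA; apply: submod_setZ => //.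
    by apply: contrapT => Ml; apply: nP; exists l; exact/asboolPn.
  case: (arg_minnP (fun l : 'I_n => l : nat) Pl0) => i Pi min_i.
  exists i; first exact/asboolPn.
  by move=> l li; apply: contrapT => /asboolPn /min_i; lia.
have [c [_ cP]] := has_index_class (GRing.submod_closedB subM) iM.
(* The quotient is generated by e_i; the coefficient a_l is the coordinate of e_l in it. *)
have /choice [a aP] : forall l, exists b, M (unit_vec l - b *: unit_vec i).
  by move=> l; exact: (cyclic_generated subM Mi cP (erefl _)).
(* Every [x] is congruent to a(x) e_i modulo [M], and a multiple of e_i lies in [M] exactly when its
   scalar is divisible by pi^2. *)
have MP x : M x <-> form_lattice a x.
  have Mx : M (x - lin_form a x *: unit_vec i).
    rewrite {1}[x]unit_vec_sum /lin_form scaler_suml -sumrB.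
    apply: submod_set_sum => // l; rewrite mulrC -scalerA -scalerBr.
    exact: submod_setZ.
  split=> [xM | [d xd]].
    apply: (annihilator_pi2 subM Mi).
    by rewrite -(subKr x (_ *: _)); apply: submod_setB.
  rewrite -(subrK (lin_form a x *: unit_vec i) x); apply: submod_setD => //.
  rewrite xd mulrC -scalerA; apply: submod_setZ => //.
  exact: (cyclic_pi2 subM Mi cP (erefl _)).
have ai : pi2_multiple (1 - a i).
  apply: (annihilator_pi2 subM Mi); rewrite scalerBl scale1r; exact: aP.
have rai : res (a i) = 1.
  have [d /(congr1 res)] := ai.
  by rewrite expr2 -mulrA res_piM rmorphB rmorph1 => /subr0_eq ->.
(* The product condition is applied to e_l - a_l e_i and e_m - a_m e_i, whose product is a_l a_m
   e_i, plus e_l if l = m. *)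
have alm l m : l != i -> m != i ->
    (l == m)%:R * res (a l) + res (a l) * res (a m) = 0.
  move=> li mi; have := mulM _ _ (aP l) (aP m); rewrite MP /form_lattice /=.
  have -> : (unit_vec l - a l *: unit_vec i) * (unit_vec m - a m *: unit_vec i) =
      (l == m)%:R *: unit_vec l + (a l * a m) *: unit_vec i.
    apply/ffunP => k; rewrite !ffunE.
    have [->|ki] := eqVneq k i.
      rewrite [i == l]eq_sym [i == m]eq_sym (negPf li) (negPf mi) !sub0r.
      rewrite -[RHS]/((l == m)%:R * 0 + a l * a m * 1 : o) mulr0 add0r.
      by rewrite -[LHS]/(- (a l * 1) * - (a m * 1) : o) mulrNN !mulr1.
    rewrite -[RHS]/((l == m)%:R * (k == l)%:R + a l * a m * 0 : o) mulr0 addr0.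
    rewrite -[LHS]/(((k == l)%:R - a l * 0) * ((k == m)%:R - a m * 0) : o).
    rewrite !mulr0 !subr0.
    by have [->|kl] := eqVneq k l; rewrite ?mul1r ?mulr1 ?mul0r ?mulr0.
  rewrite lin_formZ lin_form_linear lin_formZ !lin_form_unit pi2_multiple_pi.
  by rewrite rmorphD !rmorphM rai mulr1 rmorph_nat.
(* By [alm], residues away from [i] have pairwise product zero, so at most one is nonzero; it
   satisfies t + t^2 = 0, so t = -1. If there is none, [j] is set to [i]. *)
have [j ij resa] : exists2 j : 'I_n, (i <= j)%N &
    forall l, res (a l) = (l == i)%:R - ((l == j) && (j != i))%:R.
  case: (pickP (fun l => (l != i) && (res (a l) != 0))) => [j /andP [ji aj] | none].
    exists j.
      rewrite leqNgt; apply: contraNN aj => /min_i; rewrite MP /form_lattice /=.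
      by rewrite lin_formZ lin_form_unit pi2_multiple_pi => ->.
    move=> l; have [->|li] := eqVneq l i; first by rewrite eq_sym andbN subr0.
    rewrite ji andbT sub0r; have [->|lj] := eqVneq l j.
      have := alm j j ji ji; rewrite eqxx -mulrDl => /eqP.
      by rewrite mulf_eq0 (negPf aj) orbF addrC addr_eq0 => /eqP.
    have := alm l j li ji; rewrite (negPf lj) mul0r add0r => /eqP.
    by rewrite mulf_eq0 (negPf aj) orbF oppr0 => /eqP.
  exists i => // l; rewrite eqxx andbF subr0; have [->|li] := eqVneq l i => //.
  by have := none l; rewrite li /= => /negbFE /eqP.
pose b l : o := (l == i)%:R - ((l == j) && (j != i))%:R.
have ab l : a l - b l = pi * quo (a l - b l).
  by apply: res0P; rewrite !rmorphB !rmorph_nat resa subrr.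
(* The parameter [c] consists of the second digits of [a] once [b] is subtracted; it vanishes at [i]
   because a_i is 1 modulo pi^2. *)
exists (i, j, [ffun l => res (quo (a l - b l))]).
  rewrite inE /= ij ffunE; apply/eqP/pi2_multiple_pi; rewrite -ab /b eqxx.
  by rewrite eq_sym andbN subr0 -opprB; apply: pi2_multipleN.
have -> : M = form_lattice a by apply/seteqP; split=> x; rewrite MP.
apply: eq_form_lattice => l; rewrite -opprB; apply: pi2_multipleN.
rewrite /coef /= -/(b l) ffunE opprD addrA {1}ab -mulrBr pi2_multiple_pi.
by rewrite rmorphB /= repK subrr.
Qed.

Lemma card_pi_subalgs2_cyclic :
  has_card (pi_subalgs 2 `\` [set M | forall x, M (pi *: x)])
    ('C(n + 1, 2)%:R * q%:R ^+ (n - 1)).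
Proof.
exists #|@form_params K n|; last by rewrite card_form_params natrM natrX.
suff -> : pi_subalgs 2 `\` [set M | forall x, M (pi *: x)] =
    (fun p => form_lattice (coef p)) @` [set p | p \in @form_params K n].
  exact/card_eq_fin_image/coef_lattice_inj.
apply/seteqP; split=> [M [gM piM] | _ [p /= pP <-]]; last exact: coef_lattice_good.
by have [p] := coef_lattice_surj gM piM; exists p.
Qed.

End Lattices.

(** * Transport to subalgebras and the two counts *)

Lemma has_card_image (T U : Type) (f : T -> U) (A : set T) (c : rat) :
  injective f -> has_card A c -> has_card (f @` A) c.
Proof.
move=> fI [k Ak <-]; exists k => //.
by apply: card_eq_trans Ak; apply: inj_card_eq => x y _ _ /fI.
Qed.

Theorem mainTheorem2 (o : idomainType) (pi : o) (q n : nat)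
    (dvr_o : is_dvr o) (pi_unif : uniformizer pi)
    (compact_o : compact [set: adic pi])
    (res_q : residue_card o q) (n_ge2 : (2 <= n)%N) :
  has_card
    [set L : set (ffvec o n) |
      [/\ subalg_fin_index L, has_index L (q ^ (n + 1)) &
          L `<=` range (fun x : ffvec o n => pi *: x)]]
    (gauss_binom q n 1) /\
  has_card
    [set L : set (ffvec o n) |
      [/\ subalg_fin_index L, has_index L (q ^ (n + 2)) &
          L `<=` range (fun x : ffvec o n => pi *: x)]]
    ('C(n + 1, 2)%:R * q%:R ^+ (n - 1) + gauss_binom q n 2).
Proof.
have [_ mideal m_neq0] := dvr_o.
have pi0 : pi != 0.
  apply: contra_notN m_neq0 => /eqP pi0; rewrite pi_unif pi0.
  apply/seteqP; split=> [_ [x _ <-] | _ ->]; first by rewrite /= mul0r.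
  by exists 0; rewrite ?mul0r.
have [K [res [<- /choice [rep' rep'K] res0]]] := residue_field mideal res_q.
(* The chosen section is corrected at 0, so that a zero residue gives a zero digit. *)
pose rep a := if a == 0 then 0 else rep' a.
have repK : cancel rep res.
  by move=> a; rewrite /rep; case: eqP => [->|_]; rewrite ?rmorph0.
have rep0 : rep 0 = 0 by rewrite /rep eqxx.
have res_pi : res pi = 0 by apply/res0; rewrite pi_unif; exists 1; rewrite ?mulr1.
have /choice [quo quoP] : forall x, exists y, x = rep (res x) + pi * y.
  move=> x; have : nonunits o (x - rep (res x)).
    by apply/res0; rewrite rmorphB /= repK subrr.
  by rewrite pi_unif => -[y _ xy]; exists y; rewrite xy addrC subrK.
have res_unit x : res x != 0 -> x \is a GRing.unit.
  by apply: contraNT => /res0 ->.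
have pi_inj := @pi_scale_inj o pi n pi0.
split; rewrite (subalgs_pi_scale n pi0 repK res_pi quoP).
  apply: has_card_image => //.
  have /setIidPl <- := pi_subalgs1_above (n := n) pi0 repK rep0 res_pi quoP res_unit.
  by apply: (card_pi_subalgs_above repK rep0 res_pi quoP); exact: ltnW.
apply: has_card_image => //.
(* The submodules [M] are split according to whether they contain pi o^n; the cyclic case gives the
   first summand. *)
rewrite -(setUIDK (pi_subalgs pi K 2) [set M | forall x, M (pi *: x)]) setUC.
apply: has_cardD.
- by rewrite setDE setIACA setICl setI0.
- exact: card_pi_subalgs2_cyclic pi0 repK rep0 res_pi quoP res_unit.
- exact: (card_pi_subalgs_above repK rep0 res_pi quoP).
Qed.
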